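(* The function $\chi_{\mathrm H}$ (assigning to each admissible chain complex its infinite Euler characteristic) induces a well-defined surjective group homomorphism $K^{\mathrm H}_0(R)\to\mathbb{R}$, $[A]\mapsto\chi_{\mathrm H}(A)$. Consequently $K^{\mathrm H}_0(R)$ is an uncountable group.
   Context: $R$ is an arbitrary unital commutative Noetherian integral domain with field of fractions $Q$; $\mathbb{N}=\{1,2,3,\dots\}$. The rank of an $R$-module $A$ is $\mathrm{rank}\,A=\dim_Q(A\otimes_R Q)$. Let $M=(m_{i,j})_{i,j\in\mathbb{N}}$ be the Cesàro matrix: $m_{i,j}=1/i$ if $i\ge j$ and $m_{i,j}=0$ otherwise. A real sequence $\mathbf a=(a_n)_{n\in\mathbb{N}}$ is $M^k$-convergent with limit $\ell\in\mathbb{R}$ if the sequence $M^k\mathbf a$ converges to $\ell$; it is H-convergent (Hölder convergent) if it is $M^k$-convergent for some integer $k>0$, and then its H-limit is $\mathrm{H}\text{-}\lim\mathbf a=\lim M^k\mathbf a$ for sufficiently large $k$ (an $M^k$-convergent sequence is $M^m$-convergent with the same limit for all $m\ge k$). An H-null sequence is an H-convergent sequence with H-limit $0$. A chain complex $C$ of $R$-modules is pre-admissible if $C_n=0$ for $n<0$, all homology modules $H_nC$ are finitely generated, and the sequence $\mathbf HC=\big((-1)^{n-1}\,\mathrm{rank}\,H_{n-1}C\big)_{n\in\mathbb{N}}$ is H-convergent. Its infinite Euler characteristic is $\chi_{\mathrm H}(C)=\mathrm{H}\text{-}\lim\mathbf HC$. A pre-admissible complex $C$ is admissible if, in addition, the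 sequence $\big(\tfrac1n\mathrm{rank}\,H_{n-1}C\big)_{n\in\mathbb{N}}$ is H-null. Let $\mathcal{C}_{\mathrm H}(R)$ be the category of admissible chain complexes and arbitrary chain maps; its cofibrations are the injective chain maps, and its weak equivalences are the quasi-isomorphisms. This is a category with cofibrations and weak equivalences in the sense of Waldhausen, with $K$-groups $K^{\mathrm H}_n(R)=\pi_n\,\Omega|w\mathcal{S}_\bullet\mathcal{C}_{\mathrm H}(R)|$. The group $K^{\mathrm H}_0(R)$ is the abelian group generated by symbols $[A]$, one for each object $A$ of $\mathcal{C}_{\mathrm H}(R)$, subject to the relations $[A]=[A']$ whenever there is a weak equivalence $A\to A'$, and $[B]=[A]+[B/A]$ for every cofibration $f\colon A\to B$, where $B/A=\mathrm{coker}(f)$. *)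

(* Defs.v *)
From HB Require Import structures.
From mathcomp Require Import all_boot all_order all_algebra.
From mathcomp Require Import all_classical all_reals all_analysis.
From mathcomp.multinomials Require Import freeg.

Set Implicit Arguments.
Unset Strict Implicit.
Unset Printing Implicit Defensive.

Import Order.TTheory GRing.Theory Num.Theory numFieldNormedType.Exports.

Local Open Scope classical_set_scope.
Local Open Scope quotient_scope.
Local Open Scope ring_scope.

Section QuotientModule.
Variables (R : pzRingType) (V : lmodType R) (I : submodClosed V).

(* The library's quotients are those of Z-modules by [zmodClosed] predicates,
   a structure that [submodClosed] does not inherit from. *)
Definition submod_pred : V -> bool := fun x => x \in I.

Fact submod_pred_closed : zmod_closed submod_pred.
Proof.
split=> [|x y xI yI]; first exact: rpred0.
by rewrite /submod_pred -scaleN1r unfold_in rpredD // rpredZ.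
Qed.

HB.instance Definition _ := GRing.isZmodClosed.Build V submod_pred submod_pred_closed.

Definition submod_zmod : zmodClosed V := GRing.ZmodClosed.clone V submod_pred _.

Definition qmod := Quotient.quot submod_zmod.

HB.instance Definition _ := Choice.on qmod.
HB.instance Definition _ := EqQuotient.on qmod.
HB.instance Definition _ := GRing.Zmodule.on qmod.

Definition qproj (x : V) : qmod := \pi_qmod x.

Fact qproj_surj (a : qmod) : exists x, qproj x = a.
Proof. by exists (repr a); exact: reprK. Qed.

Lemma qprojP x y : (qproj x = qproj y) <-> (x - y \in I).
Proof.
have -> : (x - y \in I) = (qproj x == qproj y) by exact: (@Quotient.idealrBE V submod_zmod x y).
by split=> /eqP.
Qed.

Fact qprojB : {morph qproj : x y / x - y}.
Proof. exact: (raddfB \pi_(Quotient.quot submod_zmod)). Qed.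

Definition qscale (a : R) (x : qmod) : qmod := qproj (a *: repr x).

Lemma qscaleE a x : qscale a (qproj x) = qproj (a *: x).
Proof. by apply/qprojP; rewrite -scalerBr rpredZ //; apply/qprojP/reprK. Qed.

Fact qscaleA a b x : qscale a (qscale b x) = qscale (a * b) x.
Proof. by have [y <-] := qproj_surj x; rewrite !qscaleE scalerA. Qed.

Fact qscale1 x : qscale 1 x = x.
Proof. by have [y <-] := qproj_surj x; rewrite qscaleE scale1r. Qed.

HB.instance Definition _ := GRing.isZmodMorphism.Build V qmod qproj qprojB.

Fact qscaleDr a x y : qscale a (x + y) = qscale a x + qscale a y.
Proof.
have [[x' <-] [y' <-]] := (qproj_surj x, qproj_surj y).
by rewrite -raddfD !qscaleE scalerDr raddfD.
Qed.

Fact qscaleDl x a b : qscale (a + b) x = qscale a x + qscale b x.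
Proof.
by have [x' <-] := qproj_surj x; rewrite !qscaleE scalerDl raddfD.
Qed.

HB.instance Definition _ := GRing.Zmodule_isLmodule.Build R qmod
  qscaleA qscale1 qscaleDr qscaleDl.

Fact qproj_scale : scalable qproj.
Proof. by move=> a x; rewrite -qscaleE. Qed.

HB.instance Definition _ := GRing.isScalable.Build R V qmod *:%R qproj qproj_scale.
End QuotientModule.

Section QuotientLift.
Variables (R : pzRingType) (V W : lmodType R) (I : submodClosed V).
Variables (f : {linear V -> W}) (fI : forall x, x \in I -> f x = 0).

(* The map [V / I -> W] induced by [f], see [qmod_liftE]. *)
Definition qmod_lift of (forall x, x \in I -> f x = 0) :=
  fun a : qmod I => f (repr a).

Lemma qmod_liftE x : qmod_lift fI (qproj I x) = f x.
Proof. by apply/eqP; rewrite -subr_eq0 -linearB fI //; apply/qprojP/reprK. Qed.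

Fact qmod_lift_linear : linear (qmod_lift fI).
Proof.
move=> a x y; have [[x' <-] [y' <-]] := (qproj_surj x, qproj_surj y).
by rewrite -linearP !qmod_liftE linearP.
Qed.

HB.instance Definition _ :=
  GRing.isLinear.Build R (qmod I) W *:%R (qmod_lift fI) qmod_lift_linear.
End QuotientLift.

Section KernelImage.
Variables (R : pzRingType) (U V : lmodType R) (f : {linear U -> V}).

Definition ker_pred : U -> bool := fun x => f x == 0.

Fact ker_pred_closed : subsemimod_closed ker_pred.
Proof.
split; [split|] => [|x y /eqP fx /eqP fy|a x /eqP fx]; apply/eqP.
- exact: linear0.
- by rewrite linearD fx fy addr0.
- by rewrite linearZZ fx scaler0.
Qed.

HB.instance Definition _ := GRing.isSubmodClosed.Build R U ker_pred ker_pred_closed.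

Record kernel := Kernel { kernel_val : U; _ : kernel_val \in ker_pred }.

HB.instance Definition _ := [isSub for kernel_val].
HB.instance Definition _ := [Choice of kernel by <:].
HB.instance Definition _ := [SubChoice_isSubLmodule of kernel by <:].

Lemma kernelP (x : kernel) : f (kernel_val x) = 0.
Proof. exact/eqP/(valP x). Qed.

Definition im_pred : V -> bool := fun y => `[< exists x, f x = y >].

Fact im_pred_closed : subsemimod_closed im_pred.
Proof.
split; [split|]; first by apply/asboolP; exists 0; rewrite linear0.
- move=> x y /asboolP[x' <-] /asboolP[y' <-].
  by apply/asboolP; exists (x' + y'); rewrite linearD.
- by move=> a x /asboolP[x' <-]; apply/asboolP; exists (a *: x'); rewrite linearZZ.
Qed.

HB.instance Definition _ := GRing.isSubmodClosed.Build R V im_pred im_pred_closed.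

Definition im_sub : submodClosed V := GRing.SubmodClosed.clone R V im_pred _.

Definition coker := qmod im_sub.
HB.instance Definition _ := GRing.Lmodule.on coker.
End KernelImage.

Section Span.
Variables (R : pzRingType) (V : lmodType R) (S : set V).

(* The smallest submodule containing [S]. *)
Definition span_pred : V -> bool := fun x =>
  `[< forall I : V -> bool, submod_closed I -> (forall s, S s -> I s) -> I x >].

Fact span_pred_closed : subsemimod_closed span_pred.
Proof.
split; [split|] => [|x y /asboolP Sx /asboolP Sy|a x /asboolP Sx];
  apply/asboolP => I I_closed SI.
- exact: I_closed.1.
- have [I0 IP] := I_closed.
  by have := IP 1 x y (Sx I I_closed SI) (Sy I I_closed SI); rewrite scale1r.
- have [I0 IP] := I_closed.
  by have := IP a x 0 (Sx I I_closed SI) I0; rewrite addr0.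
Qed.

HB.instance Definition _ := GRing.isSubmodClosed.Build R V span_pred span_pred_closed.

Definition mspan := GRing.SubmodClosed.clone R V span_pred _.

Lemma mem_span s : S s -> s \in mspan.
Proof. by move=> Ss; apply/asboolP => I _; apply. Qed.

Lemma span_ker (W : lmodType R) (g : {linear V -> W}) :
  (forall s, S s -> g s = 0) -> forall x, x \in mspan -> g x = 0.
Proof.
move=> gS0 x /asboolP/(_ (ker_pred g)) gx; apply/eqP/gx => [|s /gS0/eqP //].
split=> [|a u v /eqP gu /eqP gv]; apply/eqP; first exact: linear0.
by rewrite linearP gu gv scaler0 addr0.
Qed.
End Span.

Section FreeModule.
Variables (R : comNzRingType) (K : choiceType) (M : lmodType R) (h : K -> M).

HB.instance Definition _ := GRing.isZmodMorphism.Build {freeg K / R} M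
  (fglift h) (lift_is_additive h).

Fact fglift_scale : scalable (fglift h : {freeg K / R} -> M).
Proof.
move=> a u; have -> : a *: u = \sum_(x <- dom u) << (a * coeff x u) *g x >> by [].
rewrite -[in RHS](freeg_sumE u) !raddf_sum; apply: eq_bigr => k _.
by rewrite -[LHS]/(fglift h _) -[RHS]/(a *: fglift h _) !liftU scalerA.
Qed.

HB.instance Definition _ := GRing.isScalable.Build R {freeg K / R} M *:%R
  (fglift h) fglift_scale.
End FreeModule.

Section Tensor.
Variables (R : comNzRingType) (M N : lmodType R).

Local Notation free := {freeg (M * N)%type / R}.
Local Notation "m '#' n" := (Freeg [:: (1, (m, n))] : free) (at level 35).

Inductive tensor_rel : set free :=
| Tensor_addl m m' n : tensor_rel ((m + m') # n - m # n - m' # n)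
| Tensor_addr m n n' : tensor_rel (m # (n + n') - m # n - m # n')
| Tensor_scalel a m n : tensor_rel ((a *: m) # n - a *: (m # n))
| Tensor_scaler a m n : tensor_rel (m # (a *: n) - a *: (m # n)).

Definition tensor := qmod (mspan tensor_rel).
HB.instance Definition _ := GRing.Lmodule.on tensor.

Definition pure_tensor (m : M) (n : N) : tensor := qproj _ (m # n).

Fact tensor_rel0 s : tensor_rel s -> qproj (mspan tensor_rel) s = 0.
Proof.
by move=> sS; rewrite -(linear0 (qproj _)); apply/qprojP; rewrite subr0 mem_span.
Qed.

Fact pure_tensor_linearl n : linear (pure_tensor^~ n).
Proof.
move=> a m m'; transitivity (pure_tensor (a *: m) n + pure_tensor m' n).
  apply/eqP; rewrite -subr_eq0 opprD addrA -!linearB; apply/eqP.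
  exact/tensor_rel0/Tensor_addl.
congr (_ + _); apply/eqP; rewrite -subr_eq0 -linearZZ -linearB; apply/eqP.
exact/tensor_rel0/Tensor_scalel.
Qed.

Fact pure_tensor_linearr m : linear (pure_tensor m).
Proof.
move=> a n n'; transitivity (pure_tensor m (a *: n) + pure_tensor m n').
  apply/eqP; rewrite -subr_eq0 opprD addrA -!linearB; apply/eqP.
  exact/tensor_rel0/Tensor_addr.
congr (_ + _); apply/eqP; rewrite -subr_eq0 -linearZZ -linearB; apply/eqP.
exact/tensor_rel0/Tensor_scaler.
Qed.

HB.instance Definition _ m := GRing.isLinear.Build R N tensor *:%R
  (pure_tensor m) (pure_tensor_linearr m).

Section Lift.
Variables (W : lmodType R) (b : M -> N -> W).

Definition bilinear_map := (forall n, linear (b^~ n)) /\ (forall m, linear (b m)).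

Hypothesis b_bilinear : bilinear_map.

Fact tensor_lift_subproof x :
  x \in mspan tensor_rel -> fglift (fun mn => b mn.1 mn.2) x = 0.
Proof.
have [bl br] := b_bilinear.
apply: span_ker => _ [] *; rewrite !linearB ?linearZZ /= !liftU !scale1r /=.
- by rewrite -[X in b (X + _)]scale1r bl scale1r addrAC addrK subrr.
- by rewrite -[X in b _ (X + _)]scale1r br scale1r addrAC addrK subrr.
- by rewrite scalerN (GRing.scalable_linear (bl _)); exact: subrr.
- by rewrite scalerN (GRing.scalable_linear (br _)); exact: subrr.
Qed.

Definition tensor_lift : tensor -> W :=
  qmod_lift tensor_lift_subproof.
HB.instance Definition _ := GRing.Linear.on tensor_lift.

Lemma tensor_liftE m n : tensor_lift (pure_tensor m n) = b m n.
Proof. by rewrite /tensor_lift qmod_liftE -[LHS]/(fglift _ _) liftU scale1r. Qed.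
End Lift.

Lemma tensor_ext (W : lmodType R) (f g : {linear tensor -> W}) :
  (forall m n, f (pure_tensor m n) = g (pure_tensor m n)) -> f =1 g.
Proof.
move=> fg a; have [x <-] := qproj_surj a.
rewrite -(freeg_sumE x) !linear_sum; apply: eq_bigr => -[m n] _.
have -> : << coeff (m, n) x *g (m, n) >> = coeff (m, n) x *: (m # n).
  by apply/eqP/freeg_eqP => z; rewrite coeffZ !coeffU mulrA mulr1.
by rewrite !linearZZ; congr (_ *: _); exact: fg.
Qed.
End Tensor.

Section FractionModule.
Variable R : idomainType.

Definition frac_scale (a : R) (x : {fraction R}) : {fraction R} :=
  FracField.tofrac a * x.

Fact frac_scaleA a b x : frac_scale a (frac_scale b x) = frac_scale (a * b) x.
Proof. by rewrite /frac_scale rmorphM mulrA. Qed.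

Fact frac_scale1 x : frac_scale 1 x = x.
Proof. by rewrite /frac_scale rmorph1 mul1r. Qed.

Fact frac_scaleDr a x y : frac_scale a (x + y) = frac_scale a x + frac_scale a y.
Proof. exact: mulrDr. Qed.

Fact frac_scaleDl x a b : frac_scale (a + b) x = frac_scale a x + frac_scale b x.
Proof. by rewrite /frac_scale rmorphD mulrDl. Qed.

HB.instance Definition _ := GRing.Zmodule_isLmodule.Build R {fraction R}
  frac_scaleA frac_scale1 frac_scaleDr frac_scaleDl.

Variable A : lmodType R.

(* [A (x)_R Q], with [Q] acting through the second factor. *)
Definition frac_ext := tensor A {fraction R}.
HB.instance Definition _ := GRing.Zmodule.on frac_ext.

Fact frac_ext_bilinear (q : {fraction R}) :
  bilinear_map (fun (m : A) (x : {fraction R}) => pure_tensor m (q * x)).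
Proof.
split=> [x|m]; first exact: pure_tensor_linearl.
move=> a x y; rewrite -pure_tensor_linearr; congr pure_tensor.
by rewrite mulrDr; congr (_ + _); exact: mulrCA.
Qed.

Definition frac_ext_scale q : frac_ext -> frac_ext :=
  tensor_lift (frac_ext_bilinear q).

End FractionModule.

Section FractionModule2.
Variables (R : idomainType) (A : lmodType R).
Local Notation Q := {fraction R}.
Implicit Types (p q : Q) (x y : frac_ext A).

Fact frac_ext_scaleE p q m :
  frac_ext_scale p (pure_tensor m q : frac_ext A) = pure_tensor m (p * q).
Proof. exact: tensor_liftE. Qed.

Fact frac_ext_scaleA p q x :
  frac_ext_scale p (frac_ext_scale q x) = frac_ext_scale (p * q) x.
Proof.
pose f := (tensor_lift (frac_ext_bilinear A p) \o
           tensor_lift (frac_ext_bilinear A q))%FUN.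
apply: (@tensor_ext _ _ _ _ f (tensor_lift (frac_ext_bilinear A (p * q)))).
by move=> m y; rewrite /f /= !tensor_liftE mulrA.
Qed.

Fact frac_ext_scale1 x : frac_ext_scale 1 x = x.
Proof.
apply: (@tensor_ext _ _ _ _ (tensor_lift (frac_ext_bilinear A 1)) idfun).
by move=> m y; rewrite /= tensor_liftE mul1r.
Qed.

Fact frac_ext_scaleDr q x y :
  frac_ext_scale q (x + y) = frac_ext_scale q x + frac_ext_scale q y.
Proof. exact: (linearD (tensor_lift (frac_ext_bilinear A q))). Qed.

Fact frac_ext_scaleDl x p q :
  frac_ext_scale (p + q) x = frac_ext_scale p x + frac_ext_scale q x.
Proof.
pose f := tensor_lift (frac_ext_bilinear A p) \+
          tensor_lift (frac_ext_bilinear A q).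
apply: (@tensor_ext _ _ _ _ (tensor_lift (frac_ext_bilinear A (p + q))) f).
move=> m y; rewrite /f /= !tensor_liftE mulrDl.
exact: (linearD (pure_tensor m)).
Qed.

HB.instance Definition _ := GRing.Zmodule_isLmodule.Build Q (frac_ext A)
  frac_ext_scaleA frac_ext_scale1 frac_ext_scaleDr frac_ext_scaleDl.
End FractionModule2.

Section Rank.

Definition is_basis (F : fieldType) (V : lmodType F) n (v : 'I_n -> V) :=
  forall x, exists! c : 'rV[F]_n, x = \sum_i c 0 i *: v i.

(* The dimension of [V]; [0] by convention if [V] has no finite basis. *)
Definition dimension (F : fieldType) (V : lmodType F) : nat :=
  xget 0%N [set n | exists v : 'I_n -> V, is_basis v].

Definition rank (R : idomainType) (A : lmodType R) : nat :=
  @dimension {fraction R} (frac_ext A).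

Definition finitely_generated (R : pzRingType) (A : lmodType R) :=
  exists (n : nat) (v : 'I_n -> A),
    forall x, exists c : 'I_n -> R, x = \sum_i c i *: v i.

Definition noetherian (R : comNzRingType) :=
  forall I : {pred R^o}, submod_closed I ->
  exists (n : nat) (v : 'I_n -> R), (forall i, v i \in I) /\
    forall x, x \in I -> exists c : 'I_n -> R, x = \sum_i c i * v i.

End Rank.

Section ChainComplex.
Variable R : pzRingType.

(* Chain complexes concentrated in nonnegative degrees. *)
Record chain_complex := ChainComplex {
  chain_obj :> nat -> lmodType R;
  chain_d : forall n, {linear chain_obj n.+1 -> chain_obj n};
  chain_dd : forall n x, chain_d n (chain_d n.+1 x) = 0
}.

Record chain_map (A B : chain_complex) := ChainMap {
  chain_fun :> forall n, {linear A n -> B n};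
  chain_comm : forall n x,
    chain_fun n (chain_d A n x) = chain_d B n (chain_fun n.+1 x)
}.

Implicit Types A B C : chain_complex.

(* The differential out of degree [n], which is zero for [n = 0]. *)
Definition chain_out C n : {linear C n -> C n.-1} :=
  match n return {linear C n -> C n.-1} with
  | 0 => \0
  | m.+1 => chain_d C m
  end.

Definition cycles C n := kernel (chain_out C n).
HB.instance Definition _ C n := GRing.Lmodule.on (cycles C n).

Fact boundary_subproof C n x : chain_d C n x \in ker_pred (chain_out C n).
Proof. by apply/eqP; case: n x => //= n x; exact: chain_dd. Qed.

Definition boundary C n (x : C n.+1) : cycles C n :=
  Kernel (boundary_subproof x).

Fact boundary_linear C n : linear (@boundary C n).
Proof. by move=> a x y; apply: val_inj; rewrite /= !linearP. Qed.

HB.instance Definition _ C n :=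
  GRing.isLinear.Build R (C n.+1) (cycles C n) *:%R (@boundary C n)
    (@boundary_linear C n).

Definition homology C n := coker (@boundary C n).
HB.instance Definition _ C n := GRing.Lmodule.on (homology C n).

Section InducedMap.
Variables (A B : chain_complex) (f : chain_map A B) (n : nat).

Fact cycles_map_subproof (z : cycles A n) :
  f n (val z) \in ker_pred (chain_out B n).
Proof.
apply/eqP; case: z => z /= /eqP; case: n z => //= m z dz.
by rewrite -chain_comm dz linear0.
Qed.

Definition cycles_map (z : cycles A n) : cycles B n :=
  Kernel (cycles_map_subproof z).

Fact cycles_map_linear : linear cycles_map.
Proof. by move=> a x y; apply: val_inj; rewrite /= !linearP. Qed.

HB.instance Definition _ :=
  GRing.isLinear.Build R (cycles A n) (cycles B n) *:%R cycles_map
    cycles_map_linear.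

Definition homology_proj (C : chain_complex) m : cycles C m -> homology C m :=
  qproj _.
HB.instance Definition _ C m := GRing.Linear.on (@homology_proj C m).

Fact homology_map_subproof z : z \in im_pred (@boundary A n) ->
  (@homology_proj B n \o cycles_map)%FUN z = 0.
Proof.
move=> /asboolP[x <-]; rewrite -(linear0 (@homology_proj B n)) /=.
apply/qprojP; rewrite subr0; apply/asboolP; exists (f n.+1 x).
by apply: val_inj; rewrite /= chain_comm.
Qed.

Definition homology_map : homology A n -> homology B n :=
  qmod_lift homology_map_subproof.
HB.instance Definition _ := GRing.Linear.on homology_map.

Lemma homology_mapE z :
  homology_map (homology_proj z) = homology_proj (cycles_map z).
Proof. exact: qmod_liftE. Qed.
End InducedMap.

Section CokernelComplex.
Variables (A B : chain_complex) (f : chain_map A B).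

Fact coker_d_subproof n x : x \in im_pred (f n.+1) ->
  (qproj (im_sub (f n)) \o chain_d B n)%FUN x = 0.
Proof.
move=> /asboolP[y <-]; rewrite -(linear0 (qproj _)) /=.
by apply/qprojP; rewrite subr0 -chain_comm; apply/asboolP; exists (chain_d A n y).
Qed.

Definition coker_d n : coker (f n.+1) -> coker (f n) :=
  qmod_lift (@coker_d_subproof n).
HB.instance Definition _ n := GRing.Linear.on (@coker_d n).

Lemma coker_dE n x :
  @coker_d n (qproj (im_sub (f n.+1)) x) = qproj (im_sub (f n)) (chain_d B n x).
Proof. exact: qmod_liftE. Qed.

Fact coker_dd n (x : coker (f n.+2)) : coker_d (coker_d x) = 0.
Proof.
have [y <-] := @qproj_surj _ _ (im_sub (f n.+2)) x.
by rewrite !coker_dE chain_dd linear0.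
Qed.

Definition coker_complex : chain_complex :=
  @ChainComplex (fun n => coker (f n)) coker_d coker_dd.
End CokernelComplex.

Definition quasi_isomorphism A B (f : chain_map A B) :=
  forall n, bijective (@homology_map A B f n).

Definition cofibration A B (f : chain_map A B) := forall n, injective (f n).

End ChainComplex.

Section Hoelder.
Variable K : realType.
Implicit Types (a : nat -> K) (l : K).

(* Sequences and matrices are indexed from [0], so [cesaro_mx i j] is
   [m_(i+1, j+1)] and the term of index [n] of a sequence is [a_(n+1)]. *)
Definition cesaro_mx (i j : nat) : K := if (j <= i)%N then i.+1%:R^-1 else 0.

(* [M a]; the entries of row [i] vanish beyond the diagonal. *)
Definition cesaro a : nat -> K :=
  fun i => \sum_(j < i.+1) cesaro_mx i j * a j.

Definition Mk_cvg k a l := iter k cesaro a @ \oo --> l.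

Definition H_convergent a := exists k l, (0 < k)%N /\ Mk_cvg k a l.

Definition H_lim a : K := get [set l | \forall k \near \oo, Mk_cvg k a l].

Definition H_null a := H_convergent a /\ H_lim a = 0.

End Hoelder.

Section Admissible.
Variables (K : realType) (R : idomainType).

Definition euler_seq (C : chain_complex R) : nat -> K :=
  fun n => (-1) ^+ n * (rank (homology C n))%:R.

Definition pre_admissible (C : chain_complex R) :=
  (forall n, finitely_generated (homology C n)) /\ H_convergent (euler_seq C).

Definition admissible (C : chain_complex R) :=
  pre_admissible C /\
  H_null (fun n => n.+1%:R^-1 * (rank (homology C n))%:R : K).

Record admissible_complex := AdmissibleComplex {
  adm_complex :> chain_complex R;
  adm_complexP : admissible adm_complex
}.

Definition chi_H (C : chain_complex R) : K := H_lim (euler_seq C).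

End Admissible.

(* Abelian groups given by generators and relations.  They do not come with an
   instance of [zmodType]: the generators of [K0] below form a type too large
   for the universe of [zmodType], [choiceType] or [set]. *)
Section AbelianPresentation.
Variable X : Type.

Inductive ab_term : Type :=
| AbGen of X
| AbZero
| AbOpp of ab_term
| AbAdd of ab_term & ab_term.

Variable rel : ab_term -> ab_term -> Prop.

Inductive ab_eq : ab_term -> ab_term -> Prop :=
| ab_eq_rel s t : rel s t -> ab_eq s t
| ab_eq_refl s : ab_eq s s
| ab_eq_sym s t : ab_eq s t -> ab_eq t s
| ab_eq_trans s t u : ab_eq s t -> ab_eq t u -> ab_eq s u
| ab_eq_opp s t : ab_eq s t -> ab_eq (AbOpp s) (AbOpp t)
| ab_eq_add s s' t t' :
    ab_eq s s' -> ab_eq t t' -> ab_eq (AbAdd s t) (AbAdd s' t')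
| ab_eq_addA s t u : ab_eq (AbAdd s (AbAdd t u)) (AbAdd (AbAdd s t) u)
| ab_eq_addC s t : ab_eq (AbAdd s t) (AbAdd t s)
| ab_eq_add0 s : ab_eq (AbAdd AbZero s) s
| ab_eq_addN s : ab_eq (AbAdd (AbOpp s) s) AbZero.

(* The quotient of [ab_term] by [ab_eq], as the type of equivalence classes. *)
Record ab_group := AbGroup {
  ab_set : ab_term -> Prop;
  ab_setP : exists t, ab_set = ab_eq t
}.

Definition ab_class (t : ab_term) : ab_group :=
  @AbGroup (ab_eq t) (ex_intro _ t erefl).

Definition ab_repr (x : ab_group) : ab_term := projT1 (cid (ab_setP x)).

Lemma ab_reprK x : ab_class (ab_repr x) = x.
Proof.
rewrite /ab_class /ab_repr; case: (cid _) => t /=; case: x => P Pt /= eqP.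
by case: _ / (esym eqP) Pt => Pt; congr AbGroup; exact: Prop_irrelevance.
Qed.

Lemma ab_classP s t : ab_class s = ab_class t <-> ab_eq s t.
Proof.
split=> [/(congr1 ab_set) /= ->|st]; first exact: ab_eq_refl.
have eq_st : ab_eq s = ab_eq t.
  apply: funext => u; apply: propext; split; apply: ab_eq_trans => //.
  exact: ab_eq_sym.
rewrite /ab_class; case: _ / eq_st (ex_intro _ t _) => ?.
by congr AbGroup; exact: Prop_irrelevance.
Qed.

Definition ab_zero : ab_group := ab_class AbZero.
Definition ab_opp x : ab_group := ab_class (AbOpp (ab_repr x)).
Definition ab_add x y : ab_group := ab_class (AbAdd (ab_repr x) (ab_repr y)).

Lemma ab_class_opp s : ab_class (AbOpp s) = ab_opp (ab_class s).
Proof. by apply/ab_classP/ab_eq_opp/ab_classP; rewrite ab_reprK. Qed.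

Lemma ab_class_add s t :
  ab_class (AbAdd s t) = ab_add (ab_class s) (ab_class t).
Proof. by apply/ab_classP/ab_eq_add; apply/ab_classP; rewrite ab_reprK. Qed.

Lemma ab_addA : associative ab_add.
Proof.
move=> x y z; rewrite -(ab_reprK x) -(ab_reprK y) -(ab_reprK z).
by rewrite -!ab_class_add; apply/ab_classP/ab_eq_addA.
Qed.

Lemma ab_addC : commutative ab_add.
Proof. by move=> x y; apply/ab_classP/ab_eq_addC. Qed.

Lemma ab_add0 : left_id ab_zero ab_add.
Proof.
move=> x; rewrite -(ab_reprK x) -ab_class_add.
exact/ab_classP/ab_eq_add0.
Qed.

Lemma ab_addN : left_inverse ab_zero ab_opp ab_add.
Proof.
move=> x; rewrite -(ab_reprK x) -ab_class_opp -ab_class_add.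
exact/ab_classP/ab_eq_addN.
Qed.

End AbelianPresentation.

Section K0.
Variables (K : realType) (R : idomainType).

(* The hypothesis that [B/A] is admissible only serves to make [B/A] one of the
   generators: the cokernel of a cofibration in [C_H(R)] is always admissible. *)
Inductive K0_rel : ab_term (admissible_complex K R) ->
                   ab_term (admissible_complex K R) -> Prop :=
| K0_weak_equivalence (A A' : admissible_complex K R) (f : chain_map A A') :
    quasi_isomorphism f -> K0_rel (AbGen A) (AbGen A')
| K0_cofibration (A B : admissible_complex K R) (f : chain_map A B)
    (admC : admissible K (coker_complex f)) :
    cofibration f ->
    K0_rel (AbGen B) (AbAdd (AbGen A) (AbGen (AdmissibleComplex admC))).

Definition K0 := ab_group K0_rel.
Definition K0_add : K0 -> K0 -> K0 := @ab_add _ K0_rel.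
Definition K0_class (A : admissible_complex K R) : K0 :=
  ab_class K0_rel (AbGen A).

End K0.

(* Main.v *)
Require Import Defs.
From HB Require Import structures.
From mathcomp Require Import all_boot all_order all_algebra.
From mathcomp Require Import all_classical all_reals all_analysis.
From mathcomp Require Import ring lra zify.

Set Implicit Arguments.
Unset Strict Implicit.
Unset Printing Implicit Defensive.

Import Order.TTheory GRing.Theory Num.Theory numFieldNormedType.Exports.

(* For a cofibration [A -> B] let [d n] be the rank of the connecting map
   [H_n (B/A) -> H_(n-1) A].  Exactness of [(-) (x) Q] and the long exact sequence
   give [HA + HC - HB = (u_n - u_(n+1))_n] with [C = B/A] and [u_n = (-1)^n d_n].
   Its Cesaro transform is [- u_(n+1) / (n+1)], bounded in absolute value by
   [rank (H_n A) / (n+1)], and the latter sequence is H-null because [A] is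
   admissible; so [chi_H] is additive.  A real [l >= 0] is the invariant of a
   complex of free modules in even degrees, with zero differentials, whose ranks
   have Cesaro mean [l]; negative reals follow as [K_0] is a group. *)

Local Open Scope ring_scope.

Local Notation "x %:F" := (FracField.tofrac x).

(** * Invariance of the dimension over a field *)

Lemma is_basis_unique (F : fieldType) (V : lmodType F) n m
  (v : 'I_n -> V) (w : 'I_m -> V) : is_basis v -> is_basis w -> n = m.
Proof.
move=> vB wB; suff le p q (x : 'I_p -> V) (y : 'I_q -> V) :
    is_basis x -> is_basis y -> (p <= q)%N.
  by apply/eqP; rewrite eqn_leq (le _ _ _ _ vB wB) (le _ _ _ _ wB vB).
move=> xB yB.
have /choice[P xP] i : exists c : 'rV[F]_q, x i = \sum_j c 0 j *: y j.
  by have [c []] := yB (x i); exists c.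
have /choice[S yS] j : exists c : 'rV[F]_p, y j = \sum_i c 0 i *: x i.
  by have [c []] := xB (y j); exists c.
(* By uniqueness of coordinates in [x], the change-of-basis matrices multiply to the identity of
   size [p], which forces [p <= q]. *)
apply: (@mulmx1_min _ _ _ (\matrix_(i, j) P i 0 j) (\matrix_(j, i) S j 0 i)).
apply/row_matrixP => i; have [c [_ c_uniq]] := xB (x i).
rewrite -(c_uniq (row i 1%:M)); first rewrite -(c_uniq (row i (_ *m _))) //.
  rewrite [LHS]xP; under eq_bigr => j _ do rewrite yS scaler_sumr.
  rewrite exchange_big; apply: eq_bigr => k _; rewrite !mxE scaler_suml.
  by apply: eq_bigr => j _; rewrite !mxE scalerA.
rewrite (bigD1 i) //= !mxE eqxx scale1r big1 ?addr0 // => k ki.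
by rewrite !mxE eq_sym (negbTE ki) scale0r.
Qed.

Lemma dimension_basis (F : fieldType) (V : lmodType F) n (v : 'I_n -> V) :
  is_basis v -> dimension V = n.
Proof.
move=> vB; apply: xget_unique => [|m [w wB]]; first by exists v.
exact: is_basis_unique wB vB.
Qed.

(** * Ranks *)

Section FractionFrames.
Variable R : idomainType.
Local Notation Q := {fraction R}.

Lemma frac_clear_denom n (u : 'rV[Q]_n) :
  exists (a : R) (c : 'I_n -> R), a != 0 /\ a%:F *: u = \row_i (c i)%:F.
Proof.
have /choice[b /choice[d bd]] i :
    exists b d, b != 0 /\ b%:F * u 0 i = d%:F.
  elim/quotW: (u 0 i) => x; exists (frac x).2, (frac x).1.
  split; first exact: denom_ratioP.
  unlock FracField.tofrac; rewrite -[LHS]FracField.pi_mul /FracField.mulf.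
  rewrite !numden_Ratio ?oner_eq0 // !mul1r; apply/eqmodP.
  rewrite /= FracField.equivfE !numden_Ratio ?denom_ratioP ?oner_eq0 //.
  by rewrite mulr1 mulrC.
exists (\prod_i b i), (fun i => (\prod_(j | j != i) b j) * d i); split.
  by apply/prodf_neq0 => i _; have [] := bd i.
apply/rowP => i; have [_ bud] := bd i.
by rewrite !mxE (bigD1 i) //= !tofracM -bud mulrA [X in X * _]mulrC.
Qed.

Section Independence.
Variable A : lmodType R.

Definition independent n (v : 'I_n -> A) := forall c : 'I_n -> R,
  \sum_i c i *: v i = 0 -> forall i, c i = 0.

(** Membership of the image of [x] in the [Q]-span of the images of the [v i] after localization,
    stated in [A] by clearing denominators. *)
Definition dependent_on n (v : 'I_n -> A) x :=
  exists (a : R) (c : 'I_n -> R), a != 0 /\ a *: x = \sum_i c i *: v i.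

Lemma dependent_on_linear n (v : 'I_n -> A) b x y :
  dependent_on v x -> dependent_on v y -> dependent_on v (b *: x + y).
Proof.
move=> [a [c [a0 ax]]] [a' [c' [a'0 ay]]].
exists (a * a'), (fun i => a' * b * c i + a * c' i); split.
  by rewrite mulf_neq0.
transitivity ((a' * b) *: (a *: x) + a *: (a' *: y)).
  by rewrite scalerDr !scalerA; congr (_ *: _ + _); ring.
rewrite ax ay !scaler_sumr -big_split; apply: eq_bigr => i _ /=.
by rewrite scalerDl !scalerA.
Qed.

(** Greedy choice among the generators: [g ord0] joins the family only if it does not depend on it,
    and then any relation has coefficient zero at [g ord0]. *)
Lemma independent_maximal m (g : 'I_m -> A) :
  exists n (v : 'I_n -> A), independent v /\ forall i, dependent_on v (g i).
Proof.
elim: m g => [|m IHm] g; first by exists 0, g; split=> [c _ []|[]].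
have [n [v [vI vg]]] := IHm (fun i => g (lift ord0 i)).
have [dep|indep] := pselect (dependent_on v (g ord0)).
  exists n, v; split=> // i; case: (unliftP ord0 i) => [j ->|-> //]; exact: vg.
exists n.+1, (fun i => oapp v (g ord0) (unlift ord0 i)); split=> [c|i].
  rewrite big_ord_recl unlift_none /=.
  under eq_bigr do rewrite liftK /=.
  have [c0|c0 cv] := eqVneq (c ord0) 0.
    rewrite c0 scale0r add0r => /vI c'0 i.
    by case: (unliftP ord0 i) => [j ->|->].
  case: indep; exists (c ord0), (fun i => - c (lift ord0 i)); split=> //.
  under eq_bigr do rewrite scaleNr.
  by rewrite sumrN; apply/eqP; rewrite -addr_eq0 cv.
case: (unliftP ord0 i) => [j ->|->].
  have [a [c [a0 ac]]] := vg j.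
  exists a, (fun i => oapp c 0 (unlift ord0 i)); split=> //.
  rewrite big_ord_recl !unlift_none /= scale0r add0r ac.
  by apply: eq_bigr => k _; rewrite liftK.
exists 1, (fun i => (i == ord0)%:R); split; first exact: oner_neq0.
rewrite big_ord_recl unlift_none /= !scale1r big1 ?addr0 // => k _.
exact: scale0r.
Qed.

(* [phi] is the localization [A -> A (x) Q = Q^n] in coordinates for which the
   images of the [v i] are the canonical basis. *)
Definition frac_frame n (phi : A -> 'rV[Q]_n) (v : 'I_n -> A) :=
  [/\ forall a x y, phi (a *: x + y) = a%:F *: phi x + phi y,
      forall i, phi (v i) = delta_mx 0 i &
      forall x, dependent_on v x].

(** The coordinates of [x] are the fractions [c i / a] of a chosen relation
    [a *: x = \sum_i c i *: v i]. Cross-multiplying two relations for [x] and using independence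
    shows that the choice is immaterial ([phiE]); linearity follows by combining relations. *)
Lemma frac_frame_exists n (v : 'I_n -> A) :
  independent v -> (forall x, dependent_on v x) ->
  exists phi, frac_frame phi v.
Proof.
move=> vI /[dup] vdep /choice[a /choice[c ac]].
pose phi x : 'rV[Q]_n := \row_i ((c x i)%:F / (a x)%:F).
have phiE b d x : b != 0 -> b *: x = \sum_i d i *: v i ->
    b%:F *: phi x = \row_i (d i)%:F.
  move=> b0 bd; have [a0 ax] := ac x; apply/rowP => i; rewrite !mxE mulrA.
  apply: (canLR (mulfK _)); first by rewrite tofrac_eq0.
  rewrite -!rmorphM; congr _%:F; apply/eqP; rewrite -subr_eq0; apply/eqP.
  move: i; apply: (vI (fun i => b * c x i - d i * a x)).
  under eq_bigr do rewrite scalerBl (mulrC _ (a x)) -!scalerA.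
  by rewrite sumrB -!scaler_sumr -ax -bd !scalerA mulrC subrr.
exists phi; split=> // [b x y|i].
  have [ax0 ax] := ac x; have [ay0 ay] := ac y.
  have ab0 : a x * a y != 0 by rewrite mulf_neq0.
  apply: (@scalerI _ _ (a x * a y)%:F); first by rewrite tofrac_eq0.
  rewrite (phiE (a x * a y) (fun i => a y * b * c x i + a x * c y i)) //.
    have -> : (a x * a y)%:F *: (b%:F *: phi x + phi y) =
        (a y * b)%:F *: ((a x)%:F *: phi x) + (a x)%:F *: ((a y)%:F *: phi y).
      by rewrite scalerDr !scalerA -!tofracM; congr (_ %:F *: _ + _); ring.
    rewrite (phiE _ _ _ ax0 ax) (phiE _ _ _ ay0 ay).
    by apply/rowP => i; rewrite !mxE tofracD !tofracM.
  transitivity ((a y * b) *: (a x *: x) + a x *: (a y *: y)).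
    by rewrite scalerDr !scalerA; congr (_ *: _ + _); ring.
  rewrite ax ay !scaler_sumr -big_split; apply: eq_bigr => i _ /=.
  by rewrite scalerDl !scalerA.
rewrite -[LHS]scale1r -[1]/(1%:F) (phiE _ (fun j => (j == i)%:R)) ?oner_neq0 //.
  by apply/rowP => j; rewrite !mxE eqxx /= rmorph_nat.
rewrite (bigD1 i) //= eqxx big1 ?addr0 // => j /negbTE ->.
by rewrite scale0r.
Qed.

Lemma finitely_generated_frame : finitely_generated A ->
  exists n (phi : A -> 'rV[Q]_n) v, frac_frame phi v.
Proof.
move=> [m [g gA]]; have [n [v [vI vg]]] := independent_maximal g.
have [x|phi phiv] := frac_frame_exists vI; last by exists n, phi, v.
have [c ->] := gA x; elim/big_rec: _ => [|i y _ yv].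
  exists 1, (fun=> 0); rewrite oner_neq0 scaler0 big1 // => i _.
  by rewrite scale0r.
exact: dependent_on_linear.
Qed.

Section FrameTheory.
Variables (n : nat) (phi : A -> 'rV[Q]_n) (v : 'I_n -> A).
Hypothesis phiv : frac_frame phi v.

Lemma frame_linear a x y : phi (a *: x + y) = a%:F *: phi x + phi y.
Proof. by have [] := phiv. Qed.

Lemma frame0 : phi 0 = 0.
Proof.
by have := frame_linear (-1) 0 0; rewrite scaler0 addr0 rmorphN1 scaleN1r addNr.
Qed.

Lemma frameD x y : phi (x + y) = phi x + phi y.
Proof. by have := frame_linear 1 x y; rewrite !scale1r. Qed.

Lemma frameZ a x : phi (a *: x) = a%:F *: phi x.
Proof. by have := frame_linear a x 0; rewrite frame0 !addr0. Qed.

Lemma frame_sum (c : 'I_n -> R) : phi (\sum_i c i *: v i) = \row_i (c i)%:F.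
Proof.
rewrite (big_morph phi frameD frame0) [RHS]row_sum_delta.
by apply: eq_bigr => i _; rewrite frameZ mxE; have [_ -> _] := phiv.
Qed.

(** The kernel of localization is torsion: if all coordinates of [x] vanish, the multiplier in a
    relation between [x] and the [v i] kills [x]. *)
Lemma frame_torsion x : phi x = 0 -> exists2 a, a != 0 & a *: x = 0.
Proof.
have [_ _ /(_ x)[a [c [a0 ax]]]] := phiv => x0; exists a => //.
have /rowP c0 : \row_i (c i)%:F = 0 :> 'rV[Q]_n.
  by rewrite -frame_sum -ax frameZ x0 scaler0.
rewrite ax big1 // => i _; have /eqP := c0 i.
by rewrite !mxE tofrac_eq0 => /eqP ->; rewrite scale0r.
Qed.

Lemma frame_surj (u : 'rV[Q]_n) : exists a x, a != 0 /\ phi x = a%:F *: u.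
Proof.
have [a [c [a0 au]]] := frac_clear_denom u.
by exists a, (\sum_i c i *: v i); rewrite frame_sum au.
Qed.

Lemma frame_eq m (M N : 'M[Q]_(n, m)) :
  (forall x, phi x *m M = phi x *m N) -> M = N.
Proof.
move=> MN; apply/row_matrixP => i; rewrite !rowE.
by have [_ <- _] := phiv.
Qed.

Fact frame_coord_bilinear (j : 'I_n) :
  bilinear_map (fun (x : A) (q : Q) => q * phi x 0 j).
Proof.
split=> [q a x y|x a p q]; last first.
  by rewrite -[a *: p]/(a%:F * p) mulrDl -mulrA.
rewrite frame_linear !mxE mulrDr; congr (_ + _); exact: mulrCA.
Qed.

(** The coordinate maps [psi j] come from the universal property of the tensor product and give
    uniqueness. Existence means that [g], which rebuilds a tensor from its coordinates, is the
    identity; this is checked on pure tensors. *)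
Lemma frame_basis : is_basis (fun i => pure_tensor (v i) (1 : Q) : frac_ext A).
Proof.
pose psi j : {linear tensor A Q -> Q} := tensor_lift (frame_coord_bilinear j).
have psiE j x q : psi j (pure_tensor x q) = q * phi x 0 j by exact: tensor_liftE.
move=> t; exists (\row_j psi j t); split.
  pose g t := \sum_i pure_tensor (v i) (psi i t).
  have g_linear : linear g.
    move=> a x y; rewrite /g scaler_sumr -big_split; apply: eq_bigr => i _.
    by rewrite !linearP.
  pose gL : {linear tensor A Q -> tensor A Q} :=
    HB.pack g (GRing.isLinear.Build _ _ _ _ g g_linear).
  transitivity (g t); last first.
    by apply: eq_bigr => i _; rewrite [RHS]frac_ext_scaleE mxE mulr1.
  apply: (@tensor_ext _ _ _ _ idfun gL) => x q /=; rewrite /g.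
  under eq_bigr do rewrite psiE.
  have [_ _ /(_ x)[a [c [a0 ax]]]] := phiv.
  have aF0 : a%:F != 0 by rewrite tofrac_eq0.
  (* Replacing [x] by [a *: x] and [q] by [q / a] leaves the pure tensor unchanged and makes its
     first factor a combination of the [v i]. *)
  pose q' := a%:F^-1 * q.
  pose pl : {linear A -> tensor A Q} := HB.pack ((@pure_tensor R A Q)^~ q')
    (GRing.isLinear.Build _ _ _ _ _ (pure_tensor_linearl q')).
  transitivity (pl (a *: x)).
    by rewrite linearZ_LR /= -linearZ; congr pure_tensor; rewrite [RHS]mulVKf.
  rewrite ax linear_sum; apply: eq_bigr => i _.
  rewrite linearZ_LR /= -linearZ; congr pure_tensor.
  have /rowP/(_ i) : a%:F *: phi x = \row_i (c i)%:F.
    by rewrite -frameZ ax frame_sum.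
  by rewrite !mxE -[c i *: q']/((c i)%:F * q') => <-; rewrite /q'; field.
move=> c ->; apply/rowP => j; rewrite mxE linear_sum (bigD1 j) //= big1.
  rewrite addr0 [X in psi j X]frac_ext_scaleE psiE mulr1.
  by have [_ -> _] := phiv; rewrite mxE !eqxx mulr1.
move=> i ij; rewrite [X in psi j X]frac_ext_scaleE psiE mulr1.
by have [_ -> _] := phiv; rewrite mxE eqxx eq_sym (negbTE ij) mulr0.
Qed.

Lemma frame_rank : rank A = n.
Proof. exact: dimension_basis frame_basis. Qed.
End FrameTheory.

End Independence.
End FractionFrames.

(** * Exactness and ranks of linear maps *)

Definition exact_at (R : pzRingType) (A B C : lmodType R)
  (f : {linear A -> B}) (g : {linear B -> C}) :=
  (forall x, g (f x) = 0) /\ (forall y, g y = 0 -> exists x, f x = y).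

Section RankOfLinearMaps.
Variable R : idomainType.
Local Notation Q := {fraction R}.
Implicit Types A B C : lmodType R.

Definition frac_map A : A -> 'rV[Q]_(rank A) :=
  xget (fun=> 0) [set phi | exists v, frac_frame phi v]%classic.

Lemma frac_mapP A : finitely_generated A -> exists v, frac_frame (@frac_map A) v.
Proof.
move=> /finitely_generated_frame[n [phi [v phiv]]].
have rankA := frame_rank phiv; case: _ / rankA in phi v phiv *.
apply: (@xgetPex _ _ [set phi | exists v, frac_frame phi v]%classic).
by exists phi, v.
Qed.

(* The matrix of [f (x) Q] in the coordinates [frac_map]. *)
Definition linear_mx A B (f : {linear A -> B}) : 'M[Q]_(rank A, rank B) :=
  xget 0 [set M | forall x, frac_map (f x) = frac_map x *m M]%classic.

Lemma linear_mxP A B (f : {linear A -> B}) :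
  finitely_generated A -> finitely_generated B ->
  forall x, frac_map (f x) = frac_map x *m linear_mx f.
Proof.
move=> /frac_mapP[v phiv] /frac_mapP[w psiw].
apply: (@xgetPex _ 0
  [set M | forall x, frac_map (f x) = frac_map x *m M]%classic).
(* The rows are the images of the frame vectors; the identity is checked after scaling by [a], since
   [a *: x] is a combination of frame vectors. *)
exists (\matrix_i frac_map (f (v i))) => x.
have [_ _ /(_ x)[a [c [a0 ax]]]] := phiv.
apply: (@scalerI _ _ a%:F); first by rewrite tofrac_eq0.
rewrite -(frameZ psiw) scalemxAl -(frameZ phiv) -linearZZ ax (frame_sum phiv).
rewrite linear_sum (big_morph _ (frameD psiw) (frame0 psiw)) mulmx_sum_row.
by apply: eq_bigr => i _; rewrite linearZZ (frameZ psiw) rowK mxE.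
Qed.

Definition maprank A B (f : {linear A -> B}) := \rank (linear_mx f).

Lemma maprank_le_codom A B (f : {linear A -> B}) : (maprank f <= rank B)%N.
Proof. exact: rank_leq_col. Qed.

Lemma maprank0 A B : finitely_generated A -> finitely_generated B ->
  maprank (\0 : {linear A -> B}) = 0%N.
Proof.
move=> Afg Bfg; have [v phiv] := frac_mapP Afg; have [w psiw] := frac_mapP Bfg.
apply/eqP; rewrite mxrank_eq0; apply/eqP; apply: (frame_eq phiv) => x.
by rewrite -linear_mxP //= mulmx0 (frame0 psiw).
Qed.

(** Localization is exact: the row space of the matrix of [f] is the kernel of the matrix of [g],
    and rank-nullity concludes. *)
Lemma exact_rank A B C (f : {linear A -> B}) (g : {linear B -> C}) :
  finitely_generated A -> finitely_generated B -> finitely_generated C ->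
  exact_at f g -> (maprank f + maprank g)%N = rank B.
Proof.
move=> Afg Bfg Cfg [gf0 g0].
have [vA phiA] := frac_mapP Afg; have [vB phiB] := frac_mapP Bfg.
have [vC phiC] := frac_mapP Cfg.
suff : (linear_mx f :=: kermx (linear_mx g))%MS.
  by move=> fg; rewrite /maprank fg mxrank_ker subnK // rank_leq_row.
apply/eqmxP/andP; split.
  apply/sub_kermxP/(frame_eq phiA) => x.
  by rewrite mulmxA -!linear_mxP // gf0 (frame0 phiC) mulmx0.
apply/rV_subP => u /sub_kermxP ug.
(* A nonzero multiple of [u] is the image of some [y] in [B]. Then [g y] is torsion, so exactness
   over [R] applies to a further multiple [b *: y]. *)
have [a [y [a0 yu]]] := frame_surj phiB u.
have [|b b0 bgy] := frame_torsion phiC (x := g y).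
  by rewrite linear_mxP // yu -scalemxAl ug scaler0.
have [|x fx] := g0 (b *: y); first by rewrite linearZZ.
have ba0 : (b * a)%:F != 0 by rewrite tofrac_eq0 mulf_neq0.
rewrite -(eqmx_scale _ ba0) tofracM -scalerA -yu -(frameZ phiB) -fx.
by rewrite linear_mxP // submxMl.
Qed.

(** Exactness of [0 -> A -> B], with the zero endomorphism of [A] in place of a map from the zero
    module; dually for surjections below. *)
Lemma maprank_inj A B (f : {linear A -> B}) :
  finitely_generated A -> finitely_generated B -> injective f ->
  maprank f = rank A.
Proof.
move=> Afg Bfg finj; rewrite -(@exact_rank _ _ _ (\0 : {linear A -> A}) f) //.
  by rewrite maprank0.
split=> [x|y fy0]; first exact: linear0.
by exists 0; apply: finj; rewrite fy0 !linear0.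
Qed.

Lemma maprank_surj A B (f : {linear A -> B}) :
  finitely_generated A -> finitely_generated B ->
  (forall y, exists x, f x = y) -> maprank f = rank B.
Proof.
move=> Afg Bfg fsurj; rewrite -(@exact_rank _ _ _ f (\0 : {linear B -> B})) //.
by rewrite maprank0 // addn0.
Qed.

Lemma rank_bij A B (f : {linear A -> B}) :
  finitely_generated A -> finitely_generated B -> bijective f ->
  rank A = rank B.
Proof.
move=> Afg Bfg [g fK gK]; rewrite -(maprank_inj Afg Bfg (can_inj fK)).
by apply: maprank_surj => // y; exists (g y).
Qed.

End RankOfLinearMaps.

(** * The long exact homology sequence *)

Section LongExactSequence.
Variables (R : pzRingType) (A B : chain_complex R) (f : chain_map A B).
Hypothesis f_inj : cofibration f.
Local Notation C := (coker_complex f).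
Local Notation pi n := (qproj (im_sub (f n))).

Lemma homology_projP (D : chain_complex R) n (z z' : cycles D n) :
  homology_proj z = homology_proj z' <->
  exists x, chain_d D n x = kernel_val z - kernel_val z'.
Proof.
rewrite qprojP; split=> [/asboolP[x xE]|[x xE]].
  by exists x; rewrite -[LHS]/(kernel_val (boundary x)) xE.
by apply/asboolP; exists x; apply: val_inj.
Qed.

Lemma homology_proj_eq0 (D : chain_complex R) n (z : cycles D n) :
  homology_proj z = 0 <-> exists x, chain_d D n x = kernel_val z.
Proof.
rewrite -(linear0 (@homology_proj _ D n)) homology_projP.
by under eq_exists do rewrite subr0.
Qed.

Lemma homology_surj (D : chain_complex R) n (h : homology D n) :
  exists z, h = homology_proj z.
Proof. by have [z <-] := qproj_surj h; exists z. Qed.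

Lemma cycle_succ (D : chain_complex R) n (z : cycles D n.+1) :
  chain_d D n (kernel_val z) = 0.
Proof. exact: kernelP z. Qed.

Lemma pi_eq0 n (b : B n) : pi n b = 0 <-> exists a, f n a = b.
Proof.
rewrite -(linear0 (pi n)) qprojP subr0; split=> [/asboolP //|[a fa]].
by apply/asboolP; exists a.
Qed.

Fact coker_map_comm n x : pi n (chain_d B n x) = chain_d C n (pi n.+1 x).
Proof. by rewrite [RHS]coker_dE. Qed.

Definition coker_map : chain_map B C :=
  @ChainMap _ B C (fun n => pi n : {linear B n -> coker (f n)})
    coker_map_comm.

(** Injectivity of [f] one degree lower reflects cycles; in degree [0] every chain is a cycle. *)
Lemma cycle_lift n (a : A n) : chain_out B n (f n a) = 0 ->
  exists z : cycles A n, kernel_val z = a.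
Proof.
move=> fa0; suff za : a \in ker_pred (chain_out A n) by exists (Defs.Kernel za).
apply/eqP; case: n a fa0 => //= n a.
by rewrite -chain_comm => fa0; apply: f_inj; rewrite fa0 linear0.
Qed.

(** The connecting map of the snake lemma as a relation. With all choices existentially quantified,
    linearity is obtained by adding choices, and well-definedness reduces to [connected0]. *)
Definition connected n (h : homology C n.+1) (k : homology A n) :=
  exists b (w : cycles C n.+1) (a : cycles A n),
    [/\ kernel_val w = pi n.+1 b, f n (kernel_val a) = chain_d B n b,
        h = homology_proj w & k = homology_proj a].

(** As [w] is a cycle, the boundary of a lift [b] vanishes in the quotient and hence comes from
    [A]. *)
Lemma connected_total n h : exists k, @connected n h k.
Proof.
have [w ->] := homology_surj h; have [b wb] := qproj_surj (kernel_val w).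
have := cycle_succ w; rewrite -wb -[LHS]coker_map_comm => /pi_eq0[a fa].
have [|z za] := @cycle_lift n a.
  by rewrite fa; case: (n) b {wb fa} => //= m b; exact: chain_dd.
by exists (homology_proj z), b, w, z; rewrite za.
Qed.

Lemma connected_linear n c h k h' k' : @connected n h k -> connected h' k' ->
  connected (c *: h + h') (c *: k + k').
Proof.
move=> [b [w [a [wb fa -> ->]]]] [b' [w' [a' [wb' fa' -> ->]]]].
exists (c *: b + b'), (c *: w + w'), (c *: a + a').
split.
- by rewrite linearP /= -wb -wb'.
- by rewrite [RHS]linearP -fa -fa' -linearP.
- by rewrite linearP.
- by rewrite linearP.
Qed.

(** If [w] is the boundary of [w'] and [b'] lifts [w'], then [b] minus the boundary of [b'] is
    [f a'] for some [a'], whose boundary is the cycle [a] by injectivity. *)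
Lemma connected0 n k : @connected n 0 k -> k = 0.
Proof.
move=> [b [w [a [wb fa /esym/homology_proj_eq0[w' dw'] ->]]]].
have [b' wb'] := qproj_surj w'.
have : pi n.+1 (b - chain_d B n.+1 b') = 0.
  by rewrite linearB /= -wb coker_map_comm wb' dw' subrr.
move=> /pi_eq0[a' fa']; apply/homology_proj_eq0; exists a'.
apply: f_inj; rewrite chain_comm fa' linearB chain_dd subr0.
exact/esym.
Qed.

Definition connecting n : homology C n.+1 -> homology A n :=
  fun h => projT1 (cid (connected_total h)).

Lemma connectingP n h k : @connecting n h = k <-> connected h k.
Proof.
have hP h' : connected h' (@connecting n h') by rewrite /connecting; case: cid.
split=> [<- //|hk]; apply/eqP; rewrite -subr_eq0; apply/eqP/connected0.
rewrite -(subrr h) -![_ - _]addrC -!scaleN1r.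
exact: connected_linear.
Qed.

Fact connecting_linear n : linear (@connecting n).
Proof.
by move=> c h h'; apply/connectingP/connected_linear; apply/connectingP.
Qed.

HB.instance Definition _ n := GRing.isLinear.Build R (homology C n.+1)
  (homology A n) *:%R (@connecting n) (@connecting_linear n).

Lemma exact_homology_mid n :
  exact_at (@homology_map _ _ _ f n) (@homology_map _ _ _ coker_map n).
Proof.
split=> h; have [z ->] := homology_surj h.
  rewrite /= !homology_mapE; apply/homology_proj_eq0; exists 0.
  by rewrite linear0 /=; apply/esym/pi_eq0; exists (kernel_val z).
rewrite /= homology_mapE => /homology_proj_eq0[w /=].
have [b <-] := qproj_surj w; rewrite -coker_map_comm => zb.
(* Lifting the bounding chain to [b] corrects [z] by a boundary to a cycle coming from [A]. *)
have /pi_eq0[a fa] : pi n (kernel_val z - chain_d B n b) = 0.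
  by rewrite linearB /= zb subrr.
have [|za zaE] := @cycle_lift n a.
  rewrite fa linearB (kernelP z) sub0r.
  by case: (n) b {z w zb a fa} => [|m] b /=; rewrite ?chain_dd ?oppr0.
exists (homology_proj za); rewrite /= homology_mapE; apply/homology_projP.
by exists (- b); rewrite /= zaE fa linearN addrAC subrr sub0r.
Qed.

Lemma exact_homology_coker n :
  exact_at (@homology_map _ _ _ coker_map n.+1) (@connecting n).
Proof.
split=> h.
  have [z ->] := homology_surj h; apply/connectingP.
  rewrite /= homology_mapE; exists (kernel_val z), (cycles_map coker_map z), 0.
  by rewrite /= !linear0 cycle_succ.
move=> /connectingP[b [w [a [wb fa -> /esym/homology_proj_eq0[a' da']]]]].
(* Subtracting [f a'] turns the lift [b] into a cycle of [B] with the same image in [C]. *)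
have bz : b - f n.+1 a' \in ker_pred (chain_out B n.+1).
  by apply/eqP; rewrite /= linearB -chain_comm da' fa subrr.
exists (@homology_proj _ B n.+1 (Defs.Kernel bz)).
rewrite /= homology_mapE; congr homology_proj; apply: val_inj; rewrite /= linearB wb [X in _ - X](_ : _ = 0) ?subr0 //.
by apply/pi_eq0; exists a'.
Qed.

Lemma exact_homology_sub n : exact_at (@connecting n) (@homology_map _ _ _ f n).
Proof.
split=> h.
  rewrite /=; have /connectingP[b [w [a [wb fa _ ->]]]] := erefl (connecting h).
  by rewrite /= homology_mapE; apply/homology_proj_eq0; exists b.
have [z ->] := homology_surj h.
rewrite /= homology_mapE => /homology_proj_eq0[b /= db].
(* The chain [b] bounds the image of [z], so it projects to a cycle of [C], whose connecting class
   is that of [z] by construction. *)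
have wz : pi n.+1 b \in ker_pred (chain_out C n.+1).
  by apply/eqP; rewrite /= -coker_map_comm; apply/pi_eq0; exists (kernel_val z).
exists (@homology_proj _ C n.+1 (Defs.Kernel wz)); apply/connectingP.
by exists b, (Defs.Kernel wz), z.
Qed.

(** The right end of the long exact sequence: in degree [0] any lift of a cycle is a cycle. *)
Lemma homology_coker_surj0 (h : homology C 0) :
  exists k, @homology_map _ _ _ coker_map 0 k = h.
Proof.
have [z ->] := homology_surj h; have [b bz] := qproj_surj (kernel_val z).
have zb : b \in ker_pred (chain_out B 0) by apply/eqP.
exists (@homology_proj _ B 0%N (Defs.Kernel zb)); rewrite /= homology_mapE.
by congr homology_proj; apply: val_inj.
Qed.

End LongExactSequence.

(** By exactness each homology rank is the sum of the ranks of the incoming and outgoing maps. In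
    the alternating sum only the ranks of the connecting maps survive; [d n.+1] is the one into
    [H_n A]. *)
Lemma homology_rank_defect (R : idomainType) (A B : chain_complex R)
    (f : chain_map A B) : cofibration f ->
  (forall n, finitely_generated (homology A n)) ->
  (forall n, finitely_generated (homology B n)) ->
  (forall n, finitely_generated (homology (coker_complex f) n)) ->
  exists d : nat -> nat, [/\ d 0%N = 0%N,
    forall n, (d n.+1 <= rank (homology A n))%N &
    forall n, (rank (homology A n) + rank (homology (coker_complex f) n) =
               rank (homology B n) + (d n + d n.+1))%N].
Proof.
move=> f_inj Afg Bfg Cfg.
exists (fun n => if n is m.+1 then maprank (connecting f_inj (n := m)) else 0%N).
split=> // n; first exact: maprank_le_codom.
have := exact_rank (Cfg n.+1) (Afg n) (Bfg n) (exact_homology_sub f_inj n).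
have := exact_rank (Afg n) (Bfg n) (Cfg n) (exact_homology_mid f_inj n).
(* Exactness at [H_n] of the cokernel, with [d 0 = 0] for the absent connecting map out of degree
   [0]. *)
move=> <- <-; have e : (maprank (@homology_map _ _ _ (coker_map f) n) +
    (if n is m.+1 then maprank (connecting f_inj (n := m)) else 0) =
    rank (homology (coker_complex f) n))%N; last by rewrite -[in LHS]e; ring.
case: n => [|n].
  rewrite addn0; apply: maprank_surj (Bfg 0%N) (Cfg 0%N) _ => h.
  exact: homology_coker_surj0.
exact: exact_rank (Bfg _) (Cfg _) (Afg _) (exact_homology_coker f_inj n).
Qed.

(** * Hoelder limits *)

Section HoelderLimits.
Local Open Scope classical_set_scope.
Variable K : realType.
Local Notation M := (@Defs.cesaro K).
Implicit Types (a b c u : nat -> K) (l m : K).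

Lemma cesaroE a n : M a n = n.+1%:R^-1 * \sum_(j < n.+1) a j.
Proof.
rewrite mulr_sumr; apply: eq_bigr => j _.
by rewrite /cesaro_mx -ltnS ltn_ord.
Qed.

(** Cesaro's theorem, applied [k' - k] times. *)
Lemma Mk_cvg_le k k' a l : (k <= k')%N -> Mk_cvg k a l -> Mk_cvg k' a l.
Proof.
move=> /subnK <-; elim: (k' - k)%N => //= j IHj /IHj /sequences.cesaro.
apply: cvg_trans; rewrite (_ : arithmetic_mean _ = iter (j + k).+1 M a) //.
by apply/funext => n; rewrite /= cesaroE /arithmetic_mean /series /= big_mkord.
Qed.

(** Two candidate limits are compared at a common later stage. The stage [k = 0], ordinary
    convergence, is allowed. *)
Lemma H_lim_unique k a l : Mk_cvg k a l -> H_lim a = l.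
Proof.
move=> kal; apply: get_unique => [|m [N _ Nam]].
  by exists k => // k' /= kk'; exact: Mk_cvg_le kal.
apply: (cvg_unique _ (Nam (maxn k N) _) (Mk_cvg_le _ kal)) => //=.
  exact: leq_maxr.
exact: leq_maxl.
Qed.

Lemma H_convergentP a : H_convergent a -> exists k, Mk_cvg k a (H_lim a).
Proof. by move=> [k [l [_ kal]]]; exists k; rewrite (H_lim_unique kal). Qed.

Lemma iter_cesaroD k a b :
  iter k M (fun n => a n + b n) = fun n => iter k M a n + iter k M b n.
Proof.
elim: k => //= k ->; apply/funext => n.
by rewrite !cesaroE big_split /= mulrDr.
Qed.

Lemma iter_cesaroN k a : iter k M (fun n => - a n) = fun n => - iter k M a n.
Proof.
by elim: k => //= k ->; apply/funext => n; rewrite !cesaroE sumrN mulrN.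
Qed.

Lemma Mk_cvgD k a b l m : Mk_cvg k a l -> Mk_cvg k b m ->
  Mk_cvg k (fun n => a n + b n) (l + m).
Proof. by rewrite /Mk_cvg iter_cesaroD; exact: cvgD. Qed.

Lemma Mk_cvgN k a l : Mk_cvg k a l -> Mk_cvg k (fun n => - a n) (- l).
Proof. by rewrite /Mk_cvg iter_cesaroN; exact: cvgN. Qed.

(** The entries of the Cesaro matrix are nonnegative, so the triangle inequality preserves
    domination. *)
Lemma iter_cesaro_le k a b :
  (forall n, `|a n| <= b n) -> forall n, `|iter k M a n| <= iter k M b n.
Proof.
move=> ab; elim: k => //= k IHk n; rewrite !cesaroE normrM normfV normr_nat.
rewrite ler_wpM2l ?invr_ge0 //; apply: le_trans (ler_norm_sum _ _ _) _.
exact: ler_sum.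
Qed.

Lemma Mk_cvg_dominated k a b :
  (forall n, `|a n| <= b n) -> Mk_cvg k b 0 -> Mk_cvg k a 0.
Proof.
move=> ab b0; apply: norm_cvg0.
apply: squeeze_cvgr (@cvg_cst _ _ _ _ _) b0; apply: nearW => n.
by rewrite normr_ge0 iter_cesaro_le.
Qed.

Lemma cesaro_telescope u n : u 0%N = 0 ->
  M (fun i => u i - u i.+1) n = - (n.+1%:R^-1 * u n.+1).
Proof.
move=> u0; rewrite cesaroE -mulrN; congr (_ * _).
rewrite -(big_mkord xpredT (fun i => u i - u i.+1)).
under eq_bigr do rewrite -opprB.
by rewrite sumrN telescope_sumr // u0 subr0.
Qed.

(* [M (u_n - u_(n+1))] is [- u_(n+1) / (n+1)], which is dominated by [e]. *)
Lemma H_lim_telescope a b c e u :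
  H_convergent a -> H_convergent c -> H_null e ->
  u 0%N = 0 -> (forall n, n.+1%:R^-1 * `|u n.+1| <= e n) ->
  (forall n, a n + c n = b n + (u n - u n.+1)) ->
  H_lim b = H_lim a + H_lim c.
Proof.
move=> /H_convergentP[ka ha] /H_convergentP[kc hc].
move=> [/H_convergentP[k hk] e0] u0 ue abc; rewrite e0 in hk.
(* One application of [M] telescopes; the other [k] act on a sequence dominated by [e]. *)
have hu : Mk_cvg k.+1 (fun n => u n - u n.+1) 0.
  rewrite /Mk_cvg iterSr; apply: (Mk_cvg_dominated _ hk) => n.
  by rewrite cesaro_telescope // normrN normrM normfV normr_nat.
pose N := maxn ka (maxn kc k.+1).
apply: (@H_lim_unique N); rewrite -[H_lim a + _]subr0.
rewrite (_ : b = fun n => a n + c n + - (u n - u n.+1)).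
  apply: Mk_cvgD (Mk_cvgD _ _) (Mk_cvgN _).
  - by apply: Mk_cvg_le ha; rewrite !leq_max leqnn.
  - by apply: Mk_cvg_le hc; rewrite !leq_max leqnn !orbT.
  - by apply: Mk_cvg_le hu; rewrite !leq_max leqnn !orbT.
by apply/funext => n; rewrite abc addrK.
Qed.

End HoelderLimits.

(** * Invariance and additivity of [chi_H] *)

Section EulerCharacteristic.
Variables (K : realType) (R : idomainType).

Lemma chi_H_quasi_isomorphism (A A' : admissible_complex K R)
    (f : chain_map A A') : quasi_isomorphism f -> chi_H K A = chi_H K A'.
Proof.
move=> f_qi; congr H_lim; apply/funext => n; congr (_ * _%:R).
have [[Afg _] _] := adm_complexP A; have [[A'fg _] _] := adm_complexP A'.
exact: rank_bij (Afg n) (A'fg n) (f_qi n).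
Qed.

Lemma chi_H_cofibration (A B : admissible_complex K R) (f : chain_map A B) :
  admissible K (coker_complex f) -> cofibration f ->
  chi_H K B = chi_H K A + chi_H K (coker_complex f).
Proof.
move=> [[Cfg Ccvg] _] f_inj.
have [[Afg Acvg] Anull] := adm_complexP A; have [[Bfg _] _] := adm_complexP B.
have [d [d0 d_le dE]] := homology_rank_defect f_inj Afg Bfg Cfg.
(* The alternating sign in [u] turns the signed sum of [d n] and [d n.+1] into the difference
   [u n - u n.+1]. *)
apply: (H_lim_telescope (u := fun n => (-1) ^+ n * (d n)%:R) Acvg Ccvg Anull).
- by rewrite d0 mulr0.
- move=> n; rewrite normrM normrX normrN1 expr1n mul1r normr_nat.
  by rewrite ler_wpM2l ?ler_nat.
move=> n; rewrite /euler_seq -mulrDr -natrD dE exprS !natrD; ring.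
Qed.

End EulerCharacteristic.

(** * Realization of all values *)

Section FreeComplex.
Variable R : idomainType.

Lemma finitely_generated_surj (A B : lmodType R) (f : {linear A -> B}) :
  (forall y, exists x, f x = y) -> finitely_generated A -> finitely_generated B.
Proof.
move=> f_surj [n [v vA]]; exists n, (f \o v) => y.
have [x <-] := f_surj y; have [c ->] := vA x.
by exists c; rewrite linear_sum; apply: eq_bigr => i _; rewrite linearZZ.
Qed.

Lemma finitely_generated_rV n : finitely_generated 'rV[R]_n.
Proof.
by exists n, (delta_mx 0) => x; exists (x 0); exact: row_sum_delta.
Qed.

Lemma rank_rV n : rank 'rV[R]_n = n.
Proof.
apply: (@frame_rank _ _ _ (map_mx (@FracField.tofrac R)) (delta_mx 0)).
split=> [a x y|i|x].
- by rewrite map_mxD map_mxZ.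
- exact: map_delta_mx.
- exists 1, (x 0); rewrite oner_neq0 scale1r; split=> //; exact: row_sum_delta.
Qed.

Variable r : nat -> nat.

Definition free_complex : chain_complex R :=
  @ChainComplex R (fun n => 'rV[R]_(r n) : lmodType R)
    (fun n => \0 : {linear 'rV[R]_(r n.+1) -> 'rV[R]_(r n)}) (fun n x => erefl).

Fact free_complex_cycle n (x : 'rV[R]_(r n)) :
  x \in ker_pred (chain_out free_complex n).
Proof. by apply/eqP; case: n x. Qed.

(** An isomorphism onto the homology, since all differentials vanish. *)
Definition free_class n (x : 'rV[R]_(r n)) : homology free_complex n :=
  homology_proj (Defs.Kernel (free_complex_cycle x) : cycles free_complex n).

Fact free_class_linear n : linear (@free_class n).
Proof.
move=> a x y; rewrite /free_class -linearP; congr homology_proj.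
exact: val_inj.
Qed.

HB.instance Definition _ n := GRing.isLinear.Build R 'rV[R]_(r n)
  (homology free_complex n) *:%R (@free_class n) (@free_class_linear n).

Lemma free_class_surj n (h : homology free_complex n) :
  exists x, free_class x = h.
Proof.
have [z ->] := homology_surj h; exists (kernel_val z).
by congr homology_proj; apply: val_inj.
Qed.

Lemma free_class_inj n : injective (@free_class n).
Proof.
move=> x y /homology_projP[z /= /esym/eqP].
by rewrite subr_eq0 => /eqP.
Qed.

Lemma homology_free_fg n : finitely_generated (homology free_complex n).
Proof.
exact: finitely_generated_surj (@free_class_surj n) (finitely_generated_rV _).
Qed.

Lemma rank_homology_free n : rank (homology free_complex n) = r n.
Proof.
have rfg := finitely_generated_rV (r n); have hfg := homology_free_fg n.
rewrite -(maprank_surj rfg hfg (@free_class_surj n)).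
by rewrite (maprank_inj rfg hfg (@free_class_inj n)) rank_rV.
Qed.
End FreeComplex.

Section Surjectivity.
Local Open Scope classical_set_scope.
Variable K : realType.

Lemma cvg_harmonic_bound (x : nat -> K) l C :
  (forall n, `|x n - l| <= C * n.+1%:R^-1) -> x @ \oo --> l.
Proof.
move=> xlC; have h0 : C * n.+1%:R^-1 @[n --> \oo] --> (0 : K).
  by rewrite -[X in _ --> X](mulr0 C); apply: cvgMr; exact: cvg_harmonic.
apply: (@squeeze_cvgr _ _ _ _ (fun n => l - C * n.+1%:R^-1)
  (fun n => l + C * n.+1%:R^-1)).
- by apply: nearW => n; rewrite -ler_distl.
- by rewrite -[X in _ --> X]subr0; apply: cvgB => //; exact: cvg_cst.
- by rewrite -[X in _ --> X]addr0; apply: cvgD => //; exact: cvg_cst.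
Qed.

(* Living in even degrees, the ranks coincide with the signed ranks; their sums
   telescope to [m * l] up to truncation. *)
Definition even_ranks (l : K) n :=
  if odd n then 0%N else (Num.truncn (n.+2%:R * l) - Num.truncn (n%:R * l))%N.

Variable l : K.
Hypothesis l_ge0 : 0 <= l.

(** There are [uphalf n] even indices below [n], and consecutive even terms telescope from
    [truncn 0 = 0]. *)
Lemma even_ranks_sum n :
  \sum_(i < n) (even_ranks l i)%:R = (Num.truncn ((uphalf n).*2%:R * l))%:R :> K.
Proof.
elim: n => [|n IHn]; first by rewrite big_ord0 mul0r Num.Theory.truncn0.
rewrite big_ord_recr /= IHn /even_ranks uphalfE /=; have [on|en] := boolP (odd n).
  by rewrite addr0 uphalf_half on.
rewrite uphalf_half (negbTE en) add0n doubleS.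
have -> : n./2.*2 = n by rewrite -[RHS]odd_double_half (negbTE en).
(* As [l >= 0], truncations increase, so the subtraction of naturals is exact. *)
by rewrite -natrD subnKC // le_truncn // ler_wpM2r // ler_nat ltnW.
Qed.

Lemma truncn_bounds (x : K) : 0 <= x -> x - 1 < (Num.truncn x)%:R <= x.
Proof. by move=> /truncn_itv/andP[? ?]; rewrite ltrBlDr natr1; apply/andP. Qed.

Lemma even_ranks_cvg : Mk_cvg 1 (fun n => (even_ranks l n)%:R) l.
Proof.
(* The even number [m] is [n + 1] or [n + 2], which costs at most [l]; truncation costs less than
   [1]. *)
apply: (@cvg_harmonic_bound _ _ (l + 1)) => n; rewrite /= cesaroE even_ranks_sum.
set m := _.*2; have /andP[n_lt_m m_le] : (n < m <= n.+2)%N by rewrite /m; lia.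
have n1 : 0 < n.+1%:R :> K by rewrite ltr0n.
have -> : n.+1%:R^-1 * (Num.truncn (m%:R * l))%:R - l =
    ((Num.truncn (m%:R * l))%:R - l * n.+1%:R) * n.+1%:R^-1.
  by field; rewrite gt_eqF.
rewrite normrM [X in _ * X <= _]ger0_norm ?invr_ge0 // ler_wpM2r ?invr_ge0 //.
have /truncn_bounds/andP[lo up] : 0 <= m%:R * l by rewrite mulr_ge0.
have : n.+1%:R * l <= m%:R * l by rewrite ler_wpM2r // ler_nat.
have : m%:R * l <= n.+2%:R * l by rewrite ler_wpM2r // ler_nat.
rewrite -[n.+2%:R]natr1 ler_norml; nra.
Qed.

Lemma even_ranks_null : H_null (fun n => n.+1%:R^-1 * (even_ranks l n)%:R : K).
Proof.
(* The ranks are bounded, so ordinary convergence holds; stage [1] appears because [H_convergent]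
   asks for a positive one. *)
suff h : Mk_cvg 0 (fun n => n.+1%:R^-1 * (even_ranks l n)%:R : K) 0.
  by split; [exists 1%N, 0; split=> //; exact: Mk_cvg_le h|exact: H_lim_unique h].
(* The arguments of the two truncations differ by [2 l], so each rank is at most [2 l + 1]. *)
apply: (@cvg_harmonic_bound _ _ (l *+ 2 + 1)) => n /=.
rewrite subr0 normrM mulrC normfV !normr_nat ler_wpM2r ?invr_ge0 //.
rewrite /even_ranks; case: ifP => _; first by rewrite addr_ge0 // mulrn_wge0.
have /truncn_bounds/andP[_ up] : 0 <= n.+2%:R * l by rewrite mulr_ge0.
have /truncn_bounds/andP[lo _] : 0 <= n%:R * l by rewrite mulr_ge0.
rewrite natrB; last by rewrite le_truncn // ler_wpM2r // ler_nat -addn2 leq_addr.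
move: up lo; rewrite -addn2 natrD; lra.
Qed.

Lemma chi_H_surj_ge0 (R : idomainType) :
  exists A : admissible_complex K R, chi_H K A = l.
Proof.
pose C := free_complex R (even_ranks l).
(* The ranks vanish in odd degrees, so the signs disappear. *)
have eulerE : euler_seq K C = fun n => (even_ranks l n)%:R.
  apply/funext => n; rewrite /euler_seq rank_homology_free /even_ranks.
  by rewrite -signr_odd; case: ifP; rewrite ?mulr0 ?mul1r.
have admC : admissible K C.
  split; first split=> [n|]; first exact: homology_free_fg.
    by rewrite eulerE; exists 1%N, l; split=> //; exact: even_ranks_cvg.
  by under eq_fun do rewrite rank_homology_free; exact: even_ranks_null.
exists (AdmissibleComplex admC); rewrite /chi_H /= eulerE.
exact: H_lim_unique even_ranks_cvg.
Qed.
End Surjectivity.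

(** A countable set has Lebesgue measure zero, whereas the whole line has infinite measure. *)
Lemma realType_uncountable (K : realType) : ~ exists f : K -> nat, injective f.
Proof.
move=> [f f_inj]; have : countable [set: K].
  by apply/countable_injP; exists f => x y _ _ /f_inj.
move=> /countable_lebesgue_measure0.
by rewrite -set_itvNyy lebesgue_measure_itv.
Qed.

(** * The homomorphism on [K0] *)

Section EvaluationOnK0.
Variables (K : realType) (R : idomainType).

Fixpoint chi_term (t : ab_term (admissible_complex K R)) : K :=
  match t with
  | AbGen A => chi_H K A
  | AbZero => 0
  | AbOpp s => - chi_term s
  | AbAdd s s' => chi_term s + chi_term s'
  end.

(** Induction on the derivation: the two defining relations are invariance and additivity of
    [chi_H], and the other rules are equality and group laws in [K]. *)
Lemma chi_term_eq s t : ab_eq (@K0_rel K R) s t -> chi_term s = chi_term t.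
Proof.
elim=> {s t} [s t [A A' f|A B f admC]|||||||||] //=.
- exact: chi_H_quasi_isomorphism.
- exact: chi_H_cofibration.
- by move=> s t u _ -> _ ->.
- by move=> s t _ ->.
- by move=> s s' t t' _ -> _ ->.
- by move=> s t u; exact: addrA.
- by move=> s t; exact: addrC.
- by move=> s; exact: add0r.
- by move=> s; exact: addNr.
Qed.

Definition chi_K0 (x : K0 K R) : K := chi_term (ab_repr x).

Lemma chi_K0_class t : chi_K0 (ab_class (@K0_rel K R) t) = chi_term t.
Proof. by apply/chi_term_eq/ab_classP; rewrite ab_reprK. Qed.

Lemma chi_K0_surj l : exists x, chi_K0 x = l.
Proof.
have [l_ge0|l_lt0] := lerP 0 l.
  have [A Al] := chi_H_surj_ge0 l_ge0 R.
  by exists (K0_class A); rewrite chi_K0_class.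
have l_ge0 : 0 <= - l by rewrite oppr_ge0 ltW.
have [A Al] := chi_H_surj_ge0 l_ge0 R.
by exists (ab_class _ (AbOpp (AbGen A))); rewrite chi_K0_class /= Al opprK.
Qed.
End EvaluationOnK0.

Theorem theorem5p3 (K : realType) (R : idomainType) (R_noeth : noetherian R) :
  (exists phi : K0 K R -> K,
    [/\ {morph phi : x y / K0_add x y >-> x + y},
        forall A : admissible_complex K R, phi (K0_class A) = chi_H K A &
        forall l : K, exists x : K0 K R, phi x = l]) /\
  ~ (exists f : K0 K R -> nat, injective f).
Proof.
split.
  exists (@chi_K0 K R); split=> [x y|A|l]; last exact: chi_K0_surj.
    by rewrite [LHS]chi_K0_class.
  by rewrite chi_K0_class.
(* A section of the surjection embeds [K] into [K0]; composing it with [f] would make [K]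
   countable. *)
move=> [f f_inj]; have /choice[s chi_s] := @chi_K0_surj K R.
apply: (@realType_uncountable K); exists (f \o s).
exact: inj_comp f_inj (can_inj chi_s).
Qed.
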